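(* Let $H$ be a Hopf algebra over a field $k$, and let $\mathcal{P}$ be the collection of all right $H$-module coalgebras which are projective as right $H$-modules. Then $\mathcal{P}$ is an idempotent radical class of $\mathbf{Coalg}\text{-}H$.
   Context: All algebras and coalgebras are over a field $k$ and $\otimes=\otimes_k$. For a bialgebra $B$, a (right) $B$-module coalgebra is a coalgebra $C$ which is a right $B$-module such that $\Delta:C\to C\otimes C$ and $\varepsilon:C\to k$ are $B$-module maps ($C\otimes C$ with the diagonal $B$-action, $k$ the trivial module). $\mathbf{Coalg}\text{-}B$ is the category of right $B$-module coalgebras. A $B$-submodule coalgebra of $C$ is a subcoalgebra invariant under the $B$-action. For subspaces $X,Y\subseteq C$, $X\wedge Y=\Delta^{-1}(X\otimes C+C\otimes Y)$. For a collection $\mathcal{R}$ of $B$-module coalgebras, a member of $\mathcal{R}$ is called an $\mathcal{R}$-coalgebra, and a $B$-submodule coalgebra of $C$ which is a member of $\mathcal{R}$ is called an $\mathcal{R}$-subcoalgebra of $C$. A non-empty collection $\mathcal{R}$ of objects of $\mathbf{Coalg}\text{-}B$ is a radical class if: (R1) every $B$-submodule coalgebra of an $\mathcal{R}$-coalgebra is an $\mathcal{R}$-coalgebra; (R2) for any $C\in\mathbf{Coalg}\text{-}B$ and any family $\{C_i\}_{i\in I}$ of $\mathcal{R}$-subcoalgebras of $C$, $\sum_{i\in I}C_i\in\mathcal{R}$. It is idempotent if moreover: (R3) for any $C\in\mathbf{Coalg}\text{-}B$ and any $\mathcal{R}$-subcoalgebras $C_1,C_2$ of $C$, $C_1\wedge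 C_2\in\mathcal{R}$. *)

(* Defs.v *)
From HB Require Import structures.
From mathcomp Require Import all_boot all_algebra.
From mathcomp Require Import boolp classical_sets.
From mathcomp Require Import freeg.

Set Implicit Arguments.
Unset Strict Implicit.
Unset Printing Implicit Defensive.

Import GRing.Theory.
Local Open Scope quotient_scope.
Local Open Scope ring_scope.
Local Open Scope classical_set_scope.

Section Tensor.
Variables (k : fieldType) (U V : lmodType k).

Local Notation F := {freeg (U * V)%type / k}.
Local Notation gen u v := (<< (u, v) >> : F).

Inductive tens_relator : set F :=
| Relator_l a u u' v :
    tens_relator (gen (a *: u + u') v - (a *: gen u v + gen u' v))
| Relator_r a u v v' :
    tens_relator (gen u (a *: v + v') - (a *: gen u v + gen u v')).

(* The submodule generated by the relators, as the intersection of all the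
   submodules that contain them. *)
Definition tens_null : {pred F} := fun x =>
  `[< forall S : {pred F},
        submod_closed S -> (forall y, tens_relator y -> y \in S) -> x \in S >].

Fact tens_null_closed : submod_closed tens_null.
Proof.
split; first by apply/asboolP=> S [].
move=> a x y /asboolP xS /asboolP yS; apply/asboolP=> S Ssub Srel.
by case: (Ssub) => _; apply; [apply: xS | apply: yS].
Qed.

HB.instance Definition _ := GRing.isSubmodClosed.Build k F tens_null
  tens_null_closed.

Definition tensor : Type := {ideal_quot (tens_null : zmodClosed F)}.

HB.instance Definition _ := GRing.Zmodule.on tensor.

Let pi : F -> tensor := \pi_tensor.

Let piD x y : pi (x + y) = pi x + pi y.
Proof. exact: raddfD. Qed.

Let pi_eq x y : pi x = pi y <-> x - y \in tens_null.
Proof.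
rewrite Quotient.idealrBE; split; [by move=> h; apply/eqP | by move/eqP].
Qed.

Definition tens_scale (a : k) (t : tensor) : tensor := pi (a *: repr t).

Let pi_scale a x : tens_scale a (pi x) = pi (a *: x).
Proof.
apply/pi_eq; rewrite -scalerBr rpredZ //; apply/pi_eq; exact: reprK.
Qed.

Let piP (t : tensor) : exists x, t = pi x.
Proof. by exists (repr t); rewrite /pi reprK. Qed.

Fact tens_scaleA a b t : tens_scale a (tens_scale b t) = tens_scale (a * b) t.
Proof. by have [x ->] := piP t; rewrite !pi_scale scalerA. Qed.

Fact tens_scale1 t : tens_scale 1 t = t.
Proof. by have [x ->] := piP t; rewrite pi_scale scale1r. Qed.

Fact tens_scaleDr a : {morph tens_scale a : s t / s + t}.
Proof.
move=> s t; have [x ->] := piP s; have [y ->] := piP t.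
by rewrite -piD !pi_scale scalerDr piD.
Qed.

Fact tens_scaleDl t : {morph tens_scale^~ t : a b / a + b}.
Proof.
by move=> a b; have [x ->] := piP t; rewrite !pi_scale scalerDl piD.
Qed.

HB.instance Definition _ := GRing.Zmodule_isLmodule.Build k tensor
  tens_scaleA tens_scale1 tens_scaleDr tens_scaleDl.

Let scale_pi a x : a *: pi x = pi (a *: x) := pi_scale a x.

Definition tens (u : U) (v : V) : tensor := pi (gen u v).

Fact tens_bilinear : bilinear_for *:%R *:%R tens.
Proof.
split=> [v a u u' | u a v v']; rewrite /tens /= scale_pi -piD.
  by apply/pi_eq/asboolP => S _ relS; apply: relS; exact: Relator_l.
by apply/pi_eq/asboolP => S _ relS; apply: relS; exact: Relator_r.
Qed.

HB.instance Definition _ :=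
  bilinear_isBilinear.Build k U V tensor *:%R *:%R tens tens_bilinear.

Section Lift.
Variables (W : lmodType k) (f : {bilinear U -> V -> W}).

Let fl : F -> W := fglift (fun p => f p.1 p.2).

Let flB x y : fl (x - y) = fl x - fl y.
Proof. exact: lift_is_additive. Qed.

Let fl_linear : linear fl.
Proof.
have fl0 : fl 0 = 0 by rewrite -(subrr 0) flB subrr.
have flN x : fl (- x) = - fl x by rewrite -[- x]add0r flB fl0 sub0r.
have flD x y : fl (x + y) = fl x + fl y by rewrite -[y]opprK flB flN !opprK.
have fl_sum I (r : seq I) (G : I -> F) :
  fl (\sum_(i <- r) G i) = \sum_(i <- r) fl (G i) by exact: big_morph.
move=> a x y; rewrite flD; congr (_ + _).
rewrite -{2}[x]freeg_sumE [a *: x]/(fgscale a x) /fgscale !fl_sum scaler_sumr.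
by apply: eq_bigr => i _; rewrite /fl !liftU scalerA.
Qed.

Let fl_null x : x \in tens_null -> fl x = 0.
Proof.
move=> /asboolP/(_ [pred y | fl y == 0]) h.
apply/eqP; rewrite -[_ == _]/(x \in [pred y | fl y == 0]); apply: h.
  split=> [|a y z]; rewrite !inE; first by rewrite -(subrr 0) flB subrr.
  by move=> /eqP fy /eqP fz; rewrite fl_linear fy fz scaler0 addr0.
move=> y []; rewrite /= => *; rewrite inE flB !fl_linear /fl !liftU !scale1r /=.
  by rewrite linearPl subrr.
by rewrite linearPr subrr.
Qed.

Fact tens_lift_subproof :
  exists g : {linear tensor -> W}, forall u v, g (tens u v) = f u v.
Proof.
have fl_pi x : fl (repr (pi x)) = fl x.
  apply/eqP; rewrite -subr_eq0 -flB; apply/eqP/fl_null.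
  by apply/pi_eq; apply: reprK.
have lin : linear (fun t : tensor => fl (repr t)).
  move=> a s t; have [x ->] := piP s; have [y ->] := piP t.
  by rewrite scale_pi -piD !fl_pi fl_linear.
pose g : {linear tensor -> W} := HB.pack (fun t : tensor => fl (repr t))
  (GRing.isLinear.Build k tensor W *:%R _ lin).
exists g => u v.
by rewrite /= fl_pi /fl liftU scale1r.
Qed.

Definition tens_lift : tensor -> W := projT1 (cid tens_lift_subproof).

HB.instance Definition _ := GRing.Linear.on tens_lift.

Lemma tens_liftE u v : tens_lift (tens u v) = f u v.
Proof. exact: (projT2 (cid tens_lift_subproof)). Qed.

End Lift.

Lemma tens_ind (P : tensor -> Prop) :
  (forall u v, P (tens u v)) -> (forall s t, P s -> P t -> P (s + t)) ->
  forall t, P t.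
Proof.
move=> Pt PD t; have [x ->] := piP t; rewrite -[x]freeg_sumE.
rewrite (big_morph pi piD (raddf0 _)); apply: big_ind => // [|[u v] _].
  by rewrite -(linear0r (tens : {bilinear U -> V -> tensor}) 0).
set c := coeff _ _.
have -> : << c *g (u, v) >> = c *: gen u v.
  by apply/eqP/freeg_eqP => z; rewrite coeffZ !coeffU mul1r.
by rewrite -scale_pi -[pi _]/(tens u v) -linearZl.
Qed.

Lemma eq_tens (W : lmodType k) (f g : {linear tensor -> W}) :
  (forall u v, f (tens u v) = g (tens u v)) -> f =1 g.
Proof.
by move=> fg; elim/tens_ind => // s t fgs fgt; rewrite !linearD fgs fgt.
Qed.

End Tensor.

Notation "U ⊗ V" := (tensor U%type V%type) (at level 40, left associativity) : type_scope.
Notation "u ⊗ v" := (tens u v) (at level 40, left associativity) : ring_scope.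

Section TensorMaps.
Variable k : fieldType.

Section Map.
Variables (U V U' V' : lmodType k).
Variables (f : {linear U -> U'}) (g : {linear V -> V'}).

Definition tmap_pure (u : U) (v : V) : U' ⊗ V' := f u ⊗ g v.

Fact tmap_pure_bilinear : bilinear_for *:%R *:%R tmap_pure.
Proof.
by split=> [v a u u' | u a v v']; rewrite /tmap_pure /= linearP ?linearPl ?linearPr.
Qed.

HB.instance Definition _ :=
  bilinear_isBilinear.Build k U V (U' ⊗ V')%type *:%R *:%R tmap_pure
    tmap_pure_bilinear.

Definition tmap : U ⊗ V -> U' ⊗ V' := tens_lift tmap_pure.

HB.instance Definition _ := GRing.Linear.on tmap.

Lemma tmapE u v : tmap (u ⊗ v) = f u ⊗ g v.
Proof. exact: tens_liftE. Qed.

End Map.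

Section Assoc.
Variables (U V W : lmodType k).

Definition tassoc_pure1 (w : W) (u : U) (v : V) : U ⊗ (V ⊗ W) := u ⊗ (v ⊗ w).

Fact tassoc_pure1_bilinear w : bilinear_for *:%R *:%R (tassoc_pure1 w).
Proof.
by split=> [v a u u' | u a v v']; rewrite /tassoc_pure1 /= !(linearPl, linearPr).
Qed.

HB.instance Definition _ w :=
  bilinear_isBilinear.Build k U V (U ⊗ (V ⊗ W))%type *:%R *:%R (tassoc_pure1 w)
    (tassoc_pure1_bilinear w).

Definition tassoc_pure (t : U ⊗ V) (w : W) : U ⊗ (V ⊗ W) :=
  tens_lift (tassoc_pure1 w) t.

Fact tassoc_pure_bilinear : bilinear_for *:%R *:%R tassoc_pure.
Proof.
split=> [w a s t | t a w w']; rewrite /tassoc_pure /=; first exact: linearP.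
elim/tens_ind: t => [u v | s t IHs IHt].
  by rewrite !tens_liftE /= /tassoc_pure1 !linearPr.
by rewrite 4!linearD /= IHs IHt addrACA.
Qed.

HB.instance Definition _ :=
  bilinear_isBilinear.Build k (U ⊗ V)%type W (U ⊗ (V ⊗ W))%type *:%R *:%R tassoc_pure
    tassoc_pure_bilinear.

Definition tassoc : U ⊗ V ⊗ W -> U ⊗ (V ⊗ W) := tens_lift tassoc_pure.

HB.instance Definition _ := GRing.Linear.on tassoc.

Lemma tassocE u v w : tassoc (u ⊗ v ⊗ w) = u ⊗ (v ⊗ w).
Proof. by rewrite /tassoc tens_liftE [LHS]tens_liftE. Qed.

End Assoc.

Section Unit.
Variable U : lmodType k.

Definition tunitl_pure (a : k^o) (u : U) : U := (a : k) *: u.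
Definition tunitr_pure (u : U) (a : k^o) : U := (a : k) *: u.

Fact tunitl_pure_bilinear : bilinear_for *:%R *:%R tunitl_pure.
Proof.
split=> [u a b b' | b a u u']; rewrite /tunitl_pure /=.
  by rewrite scalerDl scalerA.
by rewrite scalerDr !scalerA mulrC.
Qed.

Fact tunitr_pure_bilinear : bilinear_for *:%R *:%R tunitr_pure.
Proof. by case: tunitl_pure_bilinear. Qed.

HB.instance Definition _ :=
  bilinear_isBilinear.Build k k^o U U *:%R *:%R tunitl_pure
    tunitl_pure_bilinear.
HB.instance Definition _ :=
  bilinear_isBilinear.Build k U k^o U *:%R *:%R tunitr_pure
    tunitr_pure_bilinear.

Definition tunitl : k^o ⊗ U -> U := tens_lift tunitl_pure.
Definition tunitr : U ⊗ k^o -> U := tens_lift tunitr_pure.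

HB.instance Definition _ := GRing.Linear.on tunitl.
HB.instance Definition _ := GRing.Linear.on tunitr.

Lemma tunitlE a u : tunitl (a ⊗ u) = (a : k) *: u.
Proof. exact: tens_liftE. Qed.

Lemma tunitrE u a : tunitr (u ⊗ a) = (a : k) *: u.
Proof. exact: tens_liftE. Qed.

End Unit.

Section BilinearProduct.
Variables (U1 V1 W1 U2 V2 W2 : lmodType k).
Variables (m1 : {bilinear U1 -> V1 -> W1}) (m2 : {bilinear U2 -> V2 -> W2}).

Definition tmap2_pure (t : V1 ⊗ V2) (u1 : U1) (u2 : U2) : W1 ⊗ W2 :=
  tmap (m1 u1) (m2 u2) t.

Fact tmap2_pure_bilinear t : bilinear_for *:%R *:%R (tmap2_pure t).
Proof.
split=> [u2 a u u' | u1 a u u']; rewrite /tmap2_pure /=;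
  elim/tens_ind: t => [v1 v2 | s t IHs IHt].
- by rewrite !tmapE /= linearPl linearPl.
- by rewrite 4!linearD /= IHs IHt addrACA.
- by rewrite !tmapE /= linearPl linearPr.
- by rewrite 4!linearD /= IHs IHt addrACA.
Qed.

HB.instance Definition _ t :=
  bilinear_isBilinear.Build k U1 U2 (W1 ⊗ W2)%type *:%R *:%R (tmap2_pure t)
    (tmap2_pure_bilinear t).

Definition tmap2 (s : U1 ⊗ U2) (t : V1 ⊗ V2) : W1 ⊗ W2 :=
  tens_lift (tmap2_pure t) s.

Fact tmap2_bilinear : bilinear_for *:%R *:%R tmap2.
Proof.
split=> [t a s s' | s a t t']; rewrite /tmap2 /=; first exact: linearP.
elim/tens_ind: s => [u1 u2 | s s' IHs IHs'].
  by rewrite !tens_liftE /= /tmap2_pure linearP.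
by rewrite 4!linearD /= IHs IHs' addrACA.
Qed.

HB.instance Definition _ :=
  bilinear_isBilinear.Build k (U1 ⊗ U2)%type (V1 ⊗ V2)%type (W1 ⊗ W2)%type *:%R *:%R tmap2
    tmap2_bilinear.

Lemma tmap2E u1 u2 v1 v2 : tmap2 (u1 ⊗ u2) (v1 ⊗ v2) = m1 u1 v1 ⊗ m2 u2 v2.
Proof. by rewrite /tmap2 tens_liftE [LHS]tmapE. Qed.

End BilinearProduct.

Definition amul (A : algType k) (x y : A) : A := x * y.

Fact amul_bilinear (A : algType k) : bilinear_for *:%R *:%R (@amul A).
Proof.
split=> [y a x x' | x a y y']; rewrite /amul /=.
  by rewrite mulrDl scalerAl.
by rewrite mulrDr scalerAr.
Qed.

HB.instance Definition _ (A : algType k) :=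
  bilinear_isBilinear.Build k A A A *:%R *:%R (@amul A) (amul_bilinear A).

End TensorMaps.

HB.mixin Record isCoalgebra (k : fieldType) C of GRing.Lmodule k C := {
  comul : {linear C -> (C ⊗ C)%type};
  counit : {linear C -> k^o};
  comulA : forall c : C,
    tassoc (tmap comul idfun (comul c)) = tmap idfun comul (comul c);
  counitl : forall c : C, tunitl (tmap counit idfun (comul c)) = c;
  counitr : forall c : C, tunitr (tmap idfun counit (comul c)) = c
}.

#[short(type="coalgType")]
HB.structure Definition Coalgebra (k : fieldType) :=
  {C of GRing.Lmodule k C & isCoalgebra k C}.

(* [algType k] excludes the zero ring; this is no restriction here, since
   [counit1] already implies [1 != 0]. *)
HB.mixin Record isBialgebra (k : fieldType) B
    of GRing.Algebra k B & Coalgebra k B := {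
  comul1 : comul (1 : B) = 1 ⊗ 1;
  comulM : forall x y : B,
    comul (x * y) = tmap2 (@amul k B) (@amul k B) (comul x) (comul y);
  counit1 : counit (1 : B) = 1;
  counitM : forall x y : B, counit (x * y) = counit x * counit y
}.

#[short(type="bialgType")]
HB.structure Definition Bialgebra (k : fieldType) :=
  {B of GRing.Algebra k B & Coalgebra k B & isBialgebra k B}.

HB.mixin Record isHopf (k : fieldType) H of Bialgebra k H := {
  antipode : {linear H -> H};
  antipodel : forall x : H,
    tens_lift (@amul k H) (tmap antipode idfun (comul x)) = (counit x : k)%:A;
  antipoder : forall x : H,
    tens_lift (@amul k H) (tmap idfun antipode (comul x)) = (counit x : k)%:A
}.

#[short(type="hopfType")]
HB.structure Definition Hopf (k : fieldType) :=
  {H of Bialgebra k H & isHopf k H}.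

HB.mixin Record isRightModule (k : fieldType) (B : algType k) M
    of GRing.Lmodule k M := {
  ract : {bilinear M -> B -> M};
  ract1 : forall x : M, ract x 1 = x;
  ractM : forall (x : M) (a b : B), ract x (a * b) = ract (ract x a) b
}.

#[short(type="rmodType")]
HB.structure Definition RightModule (k : fieldType) (B : algType k) :=
  {M of GRing.Lmodule k M & isRightModule k B M}.

Definition is_rmod_hom (k : fieldType) (B : algType k) (M N : rmodType B)
  (f : M -> N) : Prop := forall (x : M) (b : B), f (ract x b) = ract (f x) b.

(* Quantifying over [k]-linear maps is no restriction: additive maps that
   commute with the action of [B] are [k]-linear, as [ract x a%:A = a *: x]. *)
Definition projective (k : fieldType) (B : algType k) (P : rmodType B) : Prop :=
  forall (M N : rmodType B) (g : {linear M -> N}) (f : {linear P -> N}),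
    is_rmod_hom g -> (forall y : N, exists x : M, g x = y) -> is_rmod_hom f ->
  exists h : {linear P -> M}, is_rmod_hom h /\ forall x, g (h x) = f x.

Section TrivialModule.
Variables (k : fieldType) (B : bialgType k).

Definition triv_act (x : k^o) (b : B) : k^o := x * counit b.

Fact triv_act_bilinear : bilinear_for *:%R *:%R triv_act.
Proof.
split=> [b a x x' | x a b b']; rewrite /triv_act /=.
  by rewrite mulrDl scalerAl.
by rewrite linearP mulrDr scalerAr.
Qed.

HB.instance Definition _ :=
  bilinear_isBilinear.Build k k^o B k^o *:%R *:%R triv_act triv_act_bilinear.

Fact triv_act1 x : triv_act x 1 = x.
Proof. by rewrite /triv_act counit1 mulr1. Qed.

Fact triv_actM x a b : triv_act x (a * b) = triv_act (triv_act x a) b.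
Proof. by rewrite /triv_act counitM mulrA. Qed.

HB.instance Definition _ := isRightModule.Build k B k^o triv_act1 triv_actM.

End TrivialModule.

Section DiagonalModule.
Variables (k : fieldType) (B : bialgType k) (M N : rmodType B).

Definition diag_act (t : M ⊗ N) (b : B) : M ⊗ N :=
  tmap2 (@ract k B M) (@ract k B N) t (comul b).

Fact diag_act_bilinear : bilinear_for *:%R *:%R diag_act.
Proof.
split=> [b a t t' | t a b b']; rewrite /diag_act /=; first by rewrite linearPl.
by rewrite linearP linearPr.
Qed.

HB.instance Definition _ :=
  bilinear_isBilinear.Build k (M ⊗ N)%type B (M ⊗ N)%type *:%R *:%R diag_act
    diag_act_bilinear.

Fact diag_act1 t : diag_act t 1 = t.
Proof.
rewrite /diag_act comul1; elim/tens_ind: t => [x y | s t IHs IHt].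
  by rewrite tmap2E !ract1.
by rewrite linearDl /= IHs IHt.
Qed.

Fact diag_actM t a b : diag_act t (a * b) = diag_act (diag_act t a) b.
Proof.
rewrite /diag_act comulM.
elim/tens_ind: (comul a) => [a1 a2 | a' a'' IHa' IHa'']; last first.
  by rewrite [X in tmap2 _ _ _ X]linearDl !linearDr linearDl /= IHa' IHa''.
elim/tens_ind: (comul b) => [b1 b2 | b' b'' IHb' IHb'']; last first.
  by rewrite !linearDr /= IHb' IHb''.
elim/tens_ind: t => [x y | s t IHs IHt]; last first.
  by rewrite !linearDl /= IHs IHt.
by rewrite !tmap2E !ractM.
Qed.

HB.instance Definition _ :=
  isRightModule.Build k B (M ⊗ N)%type diag_act1 diag_actM.

End DiagonalModule.

HB.mixin Record isModuleCoalgebra (k : fieldType) (B : bialgType k) C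
    of Coalgebra k C & RightModule k B C := {
  comul_hom : @is_rmod_hom k B C (C ⊗ C)%type comul;
  counit_hom : @is_rmod_hom k B C k^o counit
}.

#[short(type="modCoalgType")]
HB.structure Definition ModuleCoalgebra (k : fieldType) (B : bialgType k) :=
  {C of Coalgebra k C & RightModule k B C & isModuleCoalgebra k B C}.

Section Subspace.
Variables (k : fieldType) (V : lmodType k) (D : set V).

Definition subspace (D_sub : submod_closed [in D]) : Type := set_type D.

Hypothesis D_sub : submod_closed [in D].

HB.instance Definition _ := SubChoice.on (subspace D_sub).
HB.instance Definition _ :=
  GRing.SubChoice_isSubLmodule.Build k V [in D] (subspace D_sub)
    (GRing.submod_closed_semi D_sub).

Definition incl : subspace D_sub -> V := val.

HB.instance Definition _ := GRing.Linear.on incl.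

Lemma incl_inj : injective incl.
Proof. exact: val_inj. Qed.

Lemma inclP (x : subspace D_sub) : D (incl x).
Proof. exact/set_mem/valP. Qed.

Lemma incl_surj (v : V) : D v -> exists x : subspace D_sub, incl x = v.
Proof. by move=> Dv; exists (SigSub (mem_set Dv)). Qed.

Let D0 : D 0.
Proof. by apply: set_mem; case: D_sub. Qed.

Let Dlin a x y : D x -> D y -> D (a *: x + y).
Proof. by move=> Dx Dy; apply: set_mem; case: D_sub => _; apply; apply: mem_set. Qed.

Lemma complement_ex : exists W : set V,
  [/\ submod_closed [in W], forall x, W x -> D x -> x = 0
    & forall v, exists w d, [/\ W w, D d & v = w + d]].
Proof.
pose P (W : set V) := (forall a x y, W x -> W y -> W (a *: x + y)) /\
  (forall x, W x -> D x -> x = 0).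
have [|W [[Wlin WD] Wmax]] := @Zorn_bigcup V P.
  move=> S SP Stot; split=> [a x y [X SX Xx] [Y SY Yy] | x [X SX Xx]]; last first.
    by case: (SP _ SX) => _; apply.
  have [XY | YX] := Stot X Y SX SY.
    by exists Y => //; case: (SP _ SY) => + _; apply=> //; apply: XY.
  by exists X => //; case: (SP _ SX) => + _; apply=> //; apply: YX.
have ext v : (forall w a, W w \/ w = 0 -> D (a *: v + w) -> a *: v + w = 0) ->
    W v.
  move=> vD; apply: contrapT => Wv.
  pose W' := [set x | exists a w, (W w \/ w = 0) /\ x = a *: v + w].
  apply: (Wmax W'); last first.
    split=> [a _ _ [b [w [Ww ->]]] [c [w' [Ww' ->]]] | _ [a [w [Ww ->]]]];
      last exact: vD.
    exists (a * b + c), (a *: w + w'); split; last first.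
      by rewrite scalerDr scalerDl scalerA addrACA.
    case: Ww Ww' => [Ww|->] [Ww'|->]; rewrite ?scaler0 ?add0r ?addr0; auto.
    by left; have := Wlin (a - 1) _ _ Ww Ww; rewrite scalerBl scale1r subrK.
  split; last by move=> sub; apply/Wv/sub; exists 1, 0; rewrite scale1r addr0; auto.
  by move=> w Ww; exists 0, w; rewrite scale0r add0r; auto.
have W0 : W 0.
  by apply: ext => w a [Ww|->]; rewrite scaler0 add0r => Dw //; apply: WD.
exists W; split=> //.
  by split=> [|a x y /set_mem Wx /set_mem Wy]; apply: mem_set; auto.
move=> v; apply: contrapT => vN.
suff Wv : W v by apply: vN; exists v, 0; rewrite addr0.
apply: ext => w a; have [-> | a_neq0 Ww Dvw] := eqVneq a 0.
  by rewrite scale0r add0r => -[Ww|->] // Dw; apply: WD.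
have {}Ww : W w by case: Ww => [|->].
exfalso; apply: vN; exists (- a^-1 *: w + 0), (a^-1 *: (a *: v + w) + 0).
split; [exact: Wlin | exact: Dlin |].
by rewrite !addr0 scalerDr scalerA mulVf // scale1r addrCA scaleNr addNr addr0.
Qed.

Lemma retraction_ex :
  exists r : {linear V -> subspace D_sub}, forall x, r (incl x) = x.
Proof.
have [W [[/set_mem W0 Wlin] WD WDV]] := complement_ex.
have /choice[r rP] v : exists x : subspace D_sub, W (v - incl x).
  have [w [d [Ww /incl_surj[x <-] ->]]] := WDV v.
  by exists x; rewrite addrK.
have r_uniq v x : W (v - incl x) -> r v = x.
  move=> Wx; apply/incl_inj/eqP; rewrite -subr_eq0; apply/eqP/WD.
    have := Wlin (-1) _ _ (mem_set (rP v)) (mem_set Wx) => /set_mem.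
    by rewrite scaleN1r opprB addrA subrK.
  by rewrite -linearB; apply: inclP.
have r_lin : linear r.
  move=> a u v; apply: r_uniq.
  have := Wlin a _ _ (mem_set (rP u)) (mem_set (rP v)) => /set_mem.
  by rewrite [incl (_ + _)]linearP opprD scalerBr addrACA.
pose g : {linear V -> subspace D_sub} :=
  HB.pack r (GRing.isLinear.Build k V (subspace D_sub) *:%R r r_lin).
by exists g => x; apply: r_uniq; rewrite subrr.
Qed.

End Subspace.

Section SubTensor.
Variable k : fieldType.

(* For subspaces [X] and [Y], this is the image of [X ⊗ Y] in [U ⊗ V]. *)
Definition tens_sub (U V : lmodType k) (X : set U) (Y : set V) : set (U ⊗ V) :=
  [set t | exists n (x : 'I_n -> U) (y : 'I_n -> V),
      (forall i, X (x i) /\ Y (y i)) /\ t = \sum_i x i ⊗ y i].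

Lemma tmap_square (U V U1 V1 U2 V2 U' V' : lmodType k)
    (f1 : {linear U -> U1}) (f1' : {linear U1 -> U'})
    (f2 : {linear U -> U2}) (f2' : {linear U2 -> U'})
    (g1 : {linear V -> V1}) (g1' : {linear V1 -> V'})
    (g2 : {linear V -> V2}) (g2' : {linear V2 -> V'}) :
  (forall u, f1' (f1 u) = f2' (f2 u)) -> (forall v, g1' (g1 v) = g2' (g2 v)) ->
  forall t, tmap f1' g1' (tmap f1 g1 t) = tmap f2' g2' (tmap f2 g2 t).
Proof.
move=> ff gg; elim/tens_ind => [u v | s t IHs IHt]; first by rewrite !tmapE ff gg.
by rewrite 4!linearD /= IHs IHt.
Qed.

Lemma tmap_id (U V : lmodType k) (f : {linear U -> U}) (g : {linear V -> V}) :
  f =1 id -> g =1 id -> tmap f g =1 id.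
Proof.
move=> f1 g1; elim/tens_ind => [u v | s t IHs IHt]; first by rewrite tmapE f1 g1.
by rewrite linearD /= IHs IHt.
Qed.

Lemma tassoc_tmap (U V W U' V' W' : lmodType k) (f : {linear U -> U'})
    (g : {linear V -> V'}) (h : {linear W -> W'}) t :
  tmap f (tmap g h) (tassoc t) = tassoc (tmap (tmap f g) h t).
Proof.
elim/tens_ind: t => [s w | s t IHs IHt]; last first.
  by rewrite 4!linearD /= IHs IHt.
elim/tens_ind: s => [u v | s t IHs IHt].
  by rewrite tmapE /= tassocE !tmapE /= tassocE !tmapE.
by rewrite linearDl 4!linearD /= IHs IHt.
Qed.

End SubTensor.

Section SubModuleCoalgebra.
Variables (k : fieldType) (B : bialgType k) (C : modCoalgType B).

Record is_submodcoalg (D : set C) : Prop := IsSubModCoalg {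
  submodcoalg_closed : submod_closed [in D];
  submodcoalg_comul : forall x, D x -> tens_sub D D (comul x);
  submodcoalg_act : forall x b, D x -> D (ract x b)
}.

Variables (D : set C) (hD : is_submodcoalg D).

Definition submodcoalg : Type := subspace (submodcoalg_closed hD).

HB.instance Definition _ := GRing.Lmodule.on submodcoalg.

Let i : {linear submodcoalg -> C} := @incl k C D (submodcoalg_closed hD).

Let i_inj : injective i. Proof. exact: incl_inj. Qed.

Let tmap_i_inj : injective (tmap i i).
Proof.
have [r rK] := retraction_ex (submodcoalg_closed hD).
apply: (can_inj (g := tmap r r)) => t.
rewrite (tmap_square (f2 := idfun) (f2' := idfun) (g2 := idfun)
  (g2' := idfun)) //.
by rewrite !tmap_id.
Qed.

Let tmap_ii_inj : injective (tmap i (tmap i i)).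
Proof.
have [r rK] := retraction_ex (submodcoalg_closed hD).
have rrK t : tmap r r (tmap i i t) = t.
  rewrite (tmap_square (f2 := idfun) (f2' := idfun) (g2 := idfun)
  (g2' := idfun)) //.
  by rewrite !tmap_id.
apply: (can_inj (g := tmap r (tmap r r))) => t.
rewrite (tmap_square (f2 := idfun) (f2' := idfun) (g2 := idfun)
  (g2' := idfun)) //.
by rewrite !tmap_id.
Qed.

Fact sub_comul_subproof : 
  exists f : {linear submodcoalg -> (submodcoalg ⊗ submodcoalg)%type},
  forall x, tmap i i (f x) = comul (i x).
Proof.
have [r rK] := retraction_ex (submodcoalg_closed hD).
exists (tmap r r \o comul \o i) => x /=.
have : tens_sub D D (comul (i x)).
  by apply: (submodcoalg_comul hD); exact: inclP.
move=> [n [u [v [uvD ->]]]].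
rewrite !linear_sum /=; apply: eq_bigr => j _.
have [Du Dv] := uvD j.
have [x1 <-] := incl_surj (submodcoalg_closed hD) Du.
have [x2 <-] := incl_surj (submodcoalg_closed hD) Dv.
by rewrite !tmapE !rK.
Qed.

(* The corestriction of [comul] to [D ⊗ D]; it is unique because [D ⊗ D] embeds
   in [C ⊗ C], [k] being a field. *)
Definition sub_comul :
    {linear submodcoalg -> (submodcoalg ⊗ submodcoalg)%type} :=
  projT1 (cid sub_comul_subproof).

Let sub_comulE x : tmap i i (sub_comul x) = comul (i x).
Proof. exact: (projT2 (cid sub_comul_subproof)). Qed.

Definition sub_counit : {linear submodcoalg -> k^o} := counit \o i.

Fact sub_comulA x :
  tassoc (tmap sub_comul idfun (sub_comul x)) =
  tmap idfun sub_comul (sub_comul x).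
Proof.
apply: tmap_ii_inj; rewrite tassoc_tmap.
rewrite (tmap_square (f2 := i) (f2' := comul) (g2 := i) (g2' := idfun)) //.
rewrite sub_comulE comulA.
rewrite [RHS](tmap_square (f2 := i) (f2' := idfun) (g2 := i) (g2' := comul)) //.
by rewrite sub_comulE.
Qed.

Fact sub_counitl x : tunitl (tmap sub_counit idfun (sub_comul x)) = x.
Proof.
apply: i_inj; rewrite -[RHS]counitl -sub_comulE.
elim/tens_ind: (sub_comul x) => [u v | s t IHs IHt].
  by rewrite !tmapE !tunitlE linearZ.
by rewrite 6!linearD /= IHs IHt.
Qed.

Fact sub_counitr x : tunitr (tmap idfun sub_counit (sub_comul x)) = x.
Proof.
apply: i_inj; rewrite -[RHS]counitr -sub_comulE.
elim/tens_ind: (sub_comul x) => [u v | s t IHs IHt].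
  by rewrite !tmapE !tunitrE linearZ.
by rewrite 6!linearD /= IHs IHt.
Qed.

HB.instance Definition _ :=
  isCoalgebra.Build k submodcoalg sub_comulA sub_counitl sub_counitr.

Definition sub_act (x : submodcoalg) (b : B) : submodcoalg :=
  SigSub (mem_set (submodcoalg_act hD b (set_mem (valP x)))).

Let sub_actE x b : i (sub_act x b) = ract (i x) b.
Proof. by []. Qed.

Fact sub_act_bilinear : bilinear_for *:%R *:%R sub_act.
Proof.
split=> [b a x y | x a b b'] /=; apply: i_inj.
  by rewrite [RHS]linearP !sub_actE linearP linearPl.
by rewrite [RHS]linearP !sub_actE linearPr.
Qed.

HB.instance Definition _ :=
  bilinear_isBilinear.Build k submodcoalg B submodcoalg *:%R *:%R sub_act
    sub_act_bilinear.

Fact sub_act1 x : sub_act x 1 = x.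
Proof. by apply: i_inj; rewrite sub_actE ract1. Qed.

Fact sub_actM x a b : sub_act x (a * b) = sub_act (sub_act x a) b.
Proof. by apply: i_inj; rewrite !sub_actE ractM. Qed.

HB.instance Definition _ :=
  isRightModule.Build k B submodcoalg sub_act1 sub_actM.

Fact sub_comul_hom :
  @is_rmod_hom k B submodcoalg (submodcoalg ⊗ submodcoalg)%type sub_comul.
Proof.
move=> x b; apply: tmap_i_inj; rewrite sub_comulE sub_actE comul_hom -sub_comulE.
elim/tens_ind: (sub_comul x) => [u v | s t IHs IHt]; last first.
  by rewrite linearD 2!linearDl linearD /= IHs IHt.
rewrite tmapE -[RHS]/(tmap i i (tmap2 _ _ _ _)) -[LHS]/(tmap2 _ _ _ _).
elim/tens_ind: (comul b) => [b1 b2 | b' b'' IHb' IHb''].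
  by rewrite !tmap2E tmapE.
by rewrite 2!linearDr linearD /= IHb' IHb''.
Qed.

Fact sub_counit_hom : @is_rmod_hom k B submodcoalg k^o sub_counit.
Proof. by move=> x b; rewrite /sub_counit /= sub_actE counit_hom. Qed.

HB.instance Definition _ :=
  isModuleCoalgebra.Build k B submodcoalg sub_comul_hom sub_counit_hom.

Definition submodcoalg_incl : submodcoalg -> C := i.

HB.instance Definition _ := GRing.Linear.on submodcoalg_incl.

Lemma submodcoalg_incl_inj : injective submodcoalg_incl.
Proof. exact: i_inj. Qed.

Lemma submodcoalg_inclP c : D c <-> exists x, submodcoalg_incl x = c.
Proof.
split; first exact: incl_surj.
by move=> [x <-]; apply: inclP.
Qed.

Lemma comul_submodcoalg x :
  tmap submodcoalg_incl submodcoalg_incl (comul x) = comul (submodcoalg_incl x).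
Proof. exact: sub_comulE. Qed.

Lemma counit_submodcoalg x :
  counit x = counit (submodcoalg_incl x).
Proof. by []. Qed.

Lemma ract_submodcoalg x b :
  submodcoalg_incl (ract x b) = ract (submodcoalg_incl x) b.
Proof. by []. Qed.

End SubModuleCoalgebra.

Definition wedge (k : fieldType) (C : coalgType k) (X Y : set C) : set C :=
  [set c | exists s t,
      [/\ tens_sub X setT s, tens_sub setT Y t & comul c = s + t]].

Definition sum_sub (V : nmodType) (I : Type) (D : I -> set V) : set V :=
  [set v | exists n (i : 'I_n -> I) (x : 'I_n -> V),
      (forall j, D (i j) (x j)) /\ v = \sum_j x j].

Section RadicalClass.
Variables (k : fieldType) (B : bialgType k) (R : modCoalgType B -> Prop).

Definition is_Rsubcoalg (C : modCoalgType B) (D : set C) : Prop :=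
  exists hD : is_submodcoalg D, R (submodcoalg hD).

Record radical_class : Prop := RadicalClass {
  radical_nonempty : exists C, R C;
  radical_sub : forall (C : modCoalgType B) (D : set C)
      (hD : is_submodcoalg D), R C -> R (submodcoalg hD);
  radical_sum : forall (C : modCoalgType B) (I : Type) (D : I -> set C),
      (forall i, is_Rsubcoalg (D i)) -> is_Rsubcoalg (sum_sub D)
}.

Record idempotent_radical_class : Prop := IdempotentRadicalClass {
  idempotent_radical : radical_class;
  radical_wedge : forall (C : modCoalgType B) (D1 D2 : set C),
      is_Rsubcoalg D1 -> is_Rsubcoalg D2 -> is_Rsubcoalg (wedge D1 D2)
}.

End RadicalClass.

(* Main.v *)
Require Import Defs.
From HB Require Import structures.
From mathcomp Require Import all_boot all_algebra.
From mathcomp Require Import boolp classical_sets.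

Set Implicit Arguments.
Unset Strict Implicit.
Unset Printing Implicit Defensive.

Import GRing.Theory.
Local Open Scope ring_scope.
Local Open Scope classical_set_scope.

(** A cointegral on D is a k-linear f : C -> H with eps f = eps which is H-linear
    on D. A submodule coalgebra D is projective iff it has a cointegral: lift
    eps_D along eps_H : H -> k for one direction. Conversely, given
    cointegrals f on D and phi on E, with values in H, the map
      m ⊗ n |-> f (m S(phi(n)_1)) phi(n)_2
    agrees with f ⊗ eps on D ⊗ C and is H-linear on C ⊗ E. Taking D = E = C and
    replacing f by a k-linear lift of an H-linear map, composition with the
    comultiplication gives an H-linear lift, whence projectivity. In general, the
    composition is a cointegral on the wedge of D and E extending f on D.
    Since the wedge contains both D and E, Zorn's lemma applied to partial
    cointegrals gives a cointegral on an arbitrary sum. *)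

(** * The bialgebra as a module coalgebra over itself *)

Section RegularModule.
Variables (k : fieldType) (B : bialgType k).

(** An alias of [B], so that right multiplication is registered on [rreg] and not on [B] itself. *)
Definition rreg : Type := B.

HB.instance Definition _ := Coalgebra.copy rreg B.

Definition rreg_act (x : rreg) (b : B) : rreg := (x : B) * b.

Fact rreg_act_bilinear : bilinear_for *:%R *:%R rreg_act.
Proof. exact: amul_bilinear. Qed.

HB.instance Definition _ :=
  bilinear_isBilinear.Build k rreg B rreg *:%R *:%R rreg_act rreg_act_bilinear.

Fact rreg_act1 x : rreg_act x 1 = x.
Proof. exact: mulr1. Qed.

Fact rreg_actM x a b : rreg_act x (a * b) = rreg_act (rreg_act x a) b.
Proof. exact: mulrA. Qed.

HB.instance Definition _ := isRightModule.Build k B rreg rreg_act1 rreg_actM.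

Fact rreg_comul_hom : @is_rmod_hom k B rreg (rreg ⊗ rreg)%type comul.
Proof.
move=> x b; rewrite [LHS]comulM -[RHS]/(tmap2 _ _ _ _).
elim/tens_ind: (comul x) => [x1 x2 | s t IHs IHt]; last first.
  by rewrite !linearDl /= IHs IHt.
elim/tens_ind: (comul b) => [b1 b2 | s t IHs IHt]; last first.
  by rewrite !linearDr /= IHs IHt.
by rewrite !tmap2E.
Qed.

Fact rreg_counit_hom : @is_rmod_hom k B rreg k^o counit.
Proof. exact: counitM. Qed.

HB.instance Definition _ :=
  isModuleCoalgebra.Build k B rreg rreg_comul_hom rreg_counit_hom.

End RegularModule.

(** * Linear sections, generalized inverses and projectors *)

Section LinearAlgebra.
Variable k : fieldType.

(** A complement of the kernel of [g] maps bijectively onto [V], and [s] inverts this bijection. *)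
Lemma linear_section (U V : lmodType k) (g : {linear U -> V}) :
  (forall v, exists u, g u = v) -> exists s : {linear V -> U}, cancel s g.
Proof.
move=> gs.
have Ksub : submod_closed [in [set u | g u = 0]].
  split=> [|a x y]; rewrite !inE /= ?linear0 // => gx gy.
  by rewrite linearP gx gy scaler0 addr0.
have [W [[/set_mem W0 Wlin] WD WDV]] := complement_ex Ksub.
have {}Wlin a x y : W x -> W y -> W (a *: x + y).
  by move=> Wx Wy; apply/set_mem/Wlin; apply: mem_set.
have /choice[s sP] v : exists u, W u /\ g u = v.
  have [u <-] := gs v; have [w [d [Ww /= gd ->]]] := WDV u.
  by exists w; rewrite linearD gd addr0.
have s_uniq u v : W u -> g u = v -> s v = u.
  move=> Wu guv; have [Ws gsv] := sP v.
  apply/eqP; rewrite -subr_eq0; apply/eqP/WD.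
    by rewrite addrC -scaleN1r; apply: Wlin.
  by rewrite /= linearB gsv guv subrr.
have s_lin : linear s.
  move=> a x y; have [Wx gx] := sP x; have [Wy gy] := sP y.
  by apply: s_uniq; [apply: Wlin | rewrite linearP gx gy].
pose s' : {linear V -> U} := HB.pack s (GRing.isLinear.Build k V U *:%R s s_lin).
by exists s' => v; have [] := sP v.
Qed.

(** [q] retracts [V] onto the image of [p], then applies a linear section of [p] over that image.
    Thus [idfun \- (q \o p)] projects onto the kernel of [p]. *)
Lemma generalized_inverse (U V : lmodType k) (p : {linear U -> V}) :
  exists q : {linear V -> U}, forall u, p (q (p u)) = p u.
Proof.
pose I := [set v | exists u, p u = v].
have Isub : submod_closed [in I].
  split=> [|a _ _ /set_mem[x <-] /set_mem[y <-]]; apply: mem_set.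
    by exists 0; rewrite linear0.
  by exists (a *: x + y); rewrite linearP.
have [r rK] := retraction_ex Isub.
have Iex u : exists v : subspace Isub, incl v = p u.
  by apply: incl_surj; exists u.
have rE u : incl (r (p u)) = p u by have [v <-] := Iex u; rewrite rK.
have [|s sK] := @linear_section U (subspace Isub) (r \o p).
  move=> v; have [u uv] := inclP v; exists u.
  by rewrite /= uv rK.
by exists (s \o r) => u /=; rewrite -rE -[r _]/((r \o p) _) sK rE.
Qed.

Lemma projector_ex (V : lmodType k) (D : set V) : submod_closed [in D] ->
  exists e : {linear V -> V}, (forall v, D (e v)) /\ (forall v, D v -> e v = v).
Proof.
move=> Dsub; have [r rK] := retraction_ex Dsub.
exists (@incl _ _ _ Dsub \o r); split=> [v | v /(incl_surj Dsub)[u <-]] /=.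
  exact: inclP.
by rewrite rK.
Qed.

End LinearAlgebra.

(** * Tensors in the image of [X ⊗ Y] *)

Section TensSub.
Variables (k : fieldType) (U V : lmodType k).
Implicit Types (X : set U) (Y : set V).

Lemma tens_sub_ind X Y (P : U ⊗ V -> Prop) : P 0 ->
  (forall x y, X x -> Y y -> P (x ⊗ y)) -> (forall s t, P s -> P t -> P (s + t)) ->
  forall t, tens_sub X Y t -> P t.
Proof.
move=> P0 Pt PD _ [n [x [y [xy ->]]]].
by apply: big_ind => // i _; apply: Pt; have [] := xy i.
Qed.

Lemma tens_sub0 X Y : tens_sub X Y 0.
Proof.
exists 0, (fun=> 0), (fun=> 0); split; first by case.
by rewrite big_ord0.
Qed.

Lemma tens_sub_tens X Y x y : X x -> Y y -> tens_sub X Y (x ⊗ y).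
Proof.
by exists 1, (fun=> x), (fun=> y); rewrite big_ord_recl big_ord0 addr0.
Qed.

Lemma tens_subD X Y s t :
  tens_sub X Y s -> tens_sub X Y t -> tens_sub X Y (s + t).
Proof.
move=> [m [x [y [xy ->]]]] [n [x' [y' [xy' ->]]]].
pose pick T (f : 'I_m -> T) (g : 'I_n -> T) (i : 'I_(m + n)) :=
  match split i with inl j => f j | inr j => g j end.
exists (m + n), (pick _ x x'), (pick _ y y'); split.
  by rewrite /pick => i; case: splitP.
have splitl (i : 'I_m) : split (lshift n i) = inl i := @unsplitK m n (inl i).
have splitr (i : 'I_n) : split (rshift m i) = inr i := @unsplitK m n (inr i).
rewrite big_split_ord /=; congr (_ + _); apply: eq_bigr => i _.
  by rewrite /pick splitl.
by rewrite /pick splitr.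
Qed.

Lemma tens_subS X X' Y Y' : X `<=` X' -> Y `<=` Y' ->
  tens_sub X Y `<=` tens_sub X' Y'.
Proof.
move=> XX' YY' t [n [x [y [xy ->]]]]; exists n, x, y; split=> // i.
by have [Xx Yy] := xy i; split; [apply: XX' | apply: YY'].
Qed.

End TensSub.

Lemma tens_sub_tmap (k : fieldType) (U V U' V' : lmodType k) (X : set U')
    (Y : set V') (f : {linear U -> U'}) (g : {linear V -> V'}) t :
  (forall u, X (f u)) -> (forall v, Y (g v)) -> tens_sub X Y (tmap f g t).
Proof.
move=> fX gY; elim/tens_ind: t => [u v | s t IHs IHt].
  by rewrite tmapE; apply: tens_sub_tens.
by rewrite linearD; apply: tens_subD.
Qed.

Lemma tens_sub_ract (k : fieldType) (B : bialgType k) (M N : rmodType B)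
    (X : set M) (Y : set N) t b :
  (forall x a, X x -> X (ract x a)) -> (forall y a, Y y -> Y (ract y a)) ->
  tens_sub X Y t -> tens_sub X Y (ract t b).
Proof.
move=> Xa Ya; elim/tens_sub_ind => [|x y Xx Yy | s s' IHs IHs'].
- by rewrite linear0l; apply: tens_sub0.
- rewrite -[ract _ _]/(tmap2 _ _ _ _).
  elim/tens_ind: (comul b) => [b1 b2 | c c' IHc IHc'].
    by rewrite tmap2E; apply: tens_sub_tens; auto.
  by rewrite linearDr; apply: tens_subD.
- by rewrite linearDl; apply: tens_subD.
Qed.

(** * Untwisting the diagonal action by the antipode *)

Section Twist.
Variables (k : fieldType) (H : hopfType k) (M : rmodType H).
Local Notation R := (rreg H).

Section TwistDef.
Variable theta : {linear R -> H}.

Definition actl_pure (m : M) (t : R ⊗ R) : M ⊗ R :=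
  tmap (ract m \o theta) idfun t.

Fact actl_pure_bilinear : bilinear_for *:%R *:%R actl_pure.
Proof.
split=> [t a m m' | m a t t']; rewrite /actl_pure /=; last exact: linearP.
elim/tens_ind: t => [h1 h2 | s t IHs IHt].
  by rewrite !tmapE /= linearPl linearPl.
by rewrite 4!linearD /= IHs IHt addrACA.
Qed.

HB.instance Definition _ :=
  bilinear_isBilinear.Build k M (R ⊗ R)%type (M ⊗ R)%type *:%R *:%R actl_pure
    actl_pure_bilinear.

Definition actl : M ⊗ (R ⊗ R) -> M ⊗ R := tens_lift actl_pure.

HB.instance Definition _ := GRing.Linear.on actl.

Lemma actlE m h h' : actl (m ⊗ (h ⊗ h')) = ract m (theta h) ⊗ h'.
Proof. by rewrite /actl tens_liftE [LHS]tmapE. Qed.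

(** For [theta] the identity, this is the isomorphism m ⊗ h |-> m h_1 ⊗ h_2 from M ⊗ H with H acting
    on the right factor to M ⊗ H with the diagonal action; the antipode gives its inverse. *)
Definition twist : M ⊗ R -> M ⊗ R := actl \o tmap idfun comul.

HB.instance Definition _ := GRing.Linear.on twist.

Lemma twistE m h : twist (m ⊗ h) = tmap (ract m \o theta) idfun (comul h).
Proof. by rewrite /twist /= tmapE /actl tens_liftE. Qed.

End TwistDef.

(** The hypothesis makes [theta'] a right convolution inverse of [theta], so by coassociativity m
    theta(h_1) theta'(h_2) ⊗ h_3 collapses to m ⊗ h. *)
Lemma twistK (theta theta' : {linear R -> H}) :
  (forall h : R, tens_lift (@amul k H) (tmap theta theta' (comul h)) =
     (counit h : k)%:A) ->
  cancel (twist theta) (twist theta').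
Proof.
move=> conv; elim/tens_ind => [m h | s t IHs IHt]; last first.
  by rewrite 2!linearD /= IHs IHt.
pose f : {linear R -> M} := ract m \o theta.
rewrite twistE /twist -/f /=.
have -> : tmap idfun comul (tmap f idfun (comul h)) =
    tmap f idfun (tassoc (tmap comul idfun (comul h))).
  by rewrite comulA; apply: tmap_square.
have actlA s : actl theta' (tmap f idfun (tassoc s)) =
    tmap (ract m \o (tens_lift (@amul k H) \o tmap theta theta')) idfun s.
  elim/tens_ind: s => [s h'' | s t IHs IHt]; last first.
    by rewrite 4!linearD /= IHs IHt.
  elim/tens_ind: s => [h1 h2 | s t IHs IHt]; last first.
    by rewrite linearDl 4!linearD /= IHs IHt.
  by rewrite tassocE !tmapE /= actlE tmapE tens_liftE -ractM.
rewrite actlA; transitivity (m ⊗ tunitl (tmap counit idfun (comul h))); last first.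
  by rewrite counitl.
elim/tens_ind: (comul h) => [h1 h2 | s t IHs IHt]; last first.
  by rewrite 4!linearD linearDr /= IHs IHt.
by rewrite !tmapE /= conv tunitlE linearZr ract1 linearZl linearZr.
Qed.

Lemma twist_idE m (h : R) :
  twist (idfun : {linear R -> H}) (m ⊗ h) = ract (m ⊗ (1 : R)) (h : H).
Proof.
rewrite twistE -[RHS]/(tmap2 _ _ _ _) -[X in tmap2 _ _ _ X]/(comul h).
elim/tens_ind: (comul h) => [h1 h2 | s t IHs IHt]; last first.
  by rewrite linearD linearDr /= IHs IHt.
by rewrite tmapE tmap2E /= [ract (1 : R) _]mul1r.
Qed.

Lemma twist_idK :
  cancel (twist (idfun : {linear R -> H})) (twist (antipode : {linear R -> H})).
Proof. exact/twistK/antipoder. Qed.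

Lemma twist_antipodeK :
  cancel (twist (antipode : {linear R -> H})) (twist (idfun : {linear R -> H})).
Proof. exact/twistK/antipodel. Qed.

End Twist.

(** * The transfer map when either of its inputs is H-linear *)

Section Transfer.
Variables (k : fieldType) (H : hopfType k) (M N W : rmodType H).
Local Notation R := (rreg H).
Local Notation gamma := (twist (antipode : {linear R -> H})).

(* In Sweedler notation, [m ⊗ n] is mapped to
   [f (m S(phi(n)_1)) phi(n)_2]. *)
Definition transfer (f : {linear M -> W}) (phi : {linear N -> R}) : M ⊗ N -> W :=
  tens_lift (@ract k H W) \o tmap f (idfun : {linear R -> H}) \o
  gamma \o tmap idfun phi.

HB.instance Definition _ f phi := GRing.Linear.on (transfer f phi).

Variables (f : {linear M -> W}) (phi : {linear N -> R}).

(** With h = phi(n), the action of S(h_1) is pulled out of [f], and S(h_1) h_2 = eps(h). *)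
Lemma transfer_homl m n : (forall b, f (ract m b) = ract (f m) b) ->
  transfer f phi (m ⊗ n) = (counit (phi n) : k) *: f m.
Proof.
move=> fm; rewrite /transfer /= tmapE twistE.
have -> : (counit (phi n) : k) *: f m =
    ract (f m) (tens_lift (@amul k H) (tmap antipode idfun (comul (phi n)))).
  by rewrite [tens_lift _ _]antipodel linearZr ract1.
elim/tens_ind: (comul (phi n)) => [h1 h2 | s t IHs IHt]; last first.
  by rewrite 5!linearD linearDr /= IHs IHt.
by rewrite !tmapE /= !tens_liftE fm -ractM.
Qed.

Lemma transfer_homr m n : (forall b, phi (ract n b) = ract (phi n) b) ->
  forall b, transfer f phi (ract (m ⊗ n) b) = ract (transfer f phi (m ⊗ n)) b.
Proof.
(* [gamma] intertwines the diagonal action with the action on the right factor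
   because its inverse does, by [twist_idE]; so there is no need to know that the
   antipode is an anti-homomorphism. *)
move=> phin b; rewrite /transfer /=.
have -> : tmap idfun phi (ract (m ⊗ n) b) = ract (tmap idfun phi (m ⊗ n)) b.
  rewrite -[ract _ b]/(tmap2 _ _ _ _) -[RHS]/(tmap2 _ _ _ _).
  elim/tens_ind: (comul b) => [h1 h2 | s t IHs IHt]; last first.
    by rewrite !linearDr linearD /= IHs IHt.
  by rewrite tmap2E !tmapE tmap2E phin.
rewrite -[X in ract X b]twist_antipodeK.
elim/tens_ind: (gamma (tmap _ _ _)) => [m' h | s t IHs IHt]; last first.
  by rewrite linearD linearDl 5!linearD linearDl /= IHs IHt.
rewrite twist_idE -ractM -[h * b : H]/(ract (h : R) b : R) -twist_idE.
by rewrite !twist_idK !tmapE !tens_liftE -ractM.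
Qed.

End Transfer.

Lemma transfer_comp (k : fieldType) (H : hopfType k) (M N W X : rmodType H)
    (f : {linear M -> W}) (phi : {linear N -> rreg H}) (g : {linear W -> X}) t :
  is_rmod_hom g -> g (transfer f phi t) = transfer (g \o f) phi t.
Proof.
move=> ghom; rewrite /transfer /=.
elim/tens_ind: (twist _ _) => [m h | s s' IHs IHs']; last first.
  by rewrite 5!linearD /= IHs IHs'.
by rewrite !tmapE !tens_liftE ghom.
Qed.

(** * Swapping tensor factors and inverting the associator *)

Section Swap.
Variables (k : fieldType) (U V : lmodType k).

Definition tswap_pure (u : U) (v : V) : V ⊗ U := v ⊗ u.

Fact tswap_pure_bilinear : bilinear_for *:%R *:%R tswap_pure.
Proof.
by split=> [v a u u' | u a v v']; rewrite /tswap_pure /= ?linearPl ?linearPr.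
Qed.

HB.instance Definition _ :=
  bilinear_isBilinear.Build k U V (V ⊗ U)%type *:%R *:%R tswap_pure
    tswap_pure_bilinear.

Definition tswap : U ⊗ V -> V ⊗ U := tens_lift tswap_pure.

HB.instance Definition _ := GRing.Linear.on tswap.

Lemma tswapE u v : tswap (u ⊗ v) = v ⊗ u.
Proof. exact: tens_liftE. Qed.

End Swap.

(** Alternating swaps with [tassoc] rotates the three factors cyclically until u ⊗ (v ⊗ w) has
    become (u ⊗ v) ⊗ w. *)
Lemma tassoc_inj (k : fieldType) (U V W : lmodType k) :
  injective (@tassoc k U V W).
Proof.
apply: (can_inj (g := @tswap k W (U ⊗ V)%type \o @tassoc k W U V \o
  @tswap k V (W ⊗ U)%type \o @tassoc k V W U \o @tswap k U (V ⊗ W)%type)).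
elim/tens_ind => [s w | s t /= IHs IHt]; last first.
  by rewrite 6!linearD /= IHs IHt.
elim/tens_ind: s => [u v | s t /= IHs IHt].
  by rewrite /= tassocE !(tswapE, tassocE).
by rewrite linearDl 6!linearD /= IHs IHt.
Qed.

(** * The wedge of two submodule coalgebras *)

Section Wedge.
Variables (k : fieldType) (B : bialgType k) (C : modCoalgType B).
Implicit Types X Y : set C.

Lemma tens_sub_ker (U V U' V' : lmodType k) (X : set U) (Y : set V)
    (f : {linear U -> U'}) (g : {linear V -> V'}) t :
  (forall u, X u -> f u = 0) \/ (forall v, Y v -> g v = 0) ->
  tens_sub X Y t -> tmap f g t = 0.
Proof.
move=> fg; elim/tens_sub_ind => [|x y Xx Yy | s s' IHs IHs'].
- exact: linear0.
- by case: fg => [fX | gY]; rewrite tmapE ?fX ?gY // ?linear0l ?linear0r.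
- by rewrite linearD /= IHs IHs' addr0.
Qed.

Lemma subset_wedgel X Y : is_submodcoalg X -> X `<=` wedge X Y.
Proof.
move=> hX x /(submodcoalg_comul hX) Xx; exists (comul x), 0.
split; [exact: tens_subS Xx | exact: tens_sub0 | by rewrite addr0].
Qed.

Lemma subset_wedger X Y : is_submodcoalg Y -> Y `<=` wedge X Y.
Proof.
move=> hY y /(submodcoalg_comul hY) Yy; exists 0, (comul y).
split; [exact: tens_sub0 | exact: tens_subS Yy | by rewrite add0r].
Qed.

(** The wedge is the kernel of p = (p1 ⊗ p2) Δ, where p1 and p2 are projections with kernels X and
    Y. On the wedge, coassociativity makes (p ⊗ id) Δ and (id ⊗ p) Δ vanish, which places Δ(d) in
    ker p ⊗ ker p. *)
Lemma wedge_submodcoalg X Y :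
  is_submodcoalg X -> is_submodcoalg Y -> is_submodcoalg (wedge X Y).
Proof.
move=> hX hY.
have [e1 [e1X e1K]] := projector_ex (submodcoalg_closed hX).
have [e2 [e2Y e2K]] := projector_ex (submodcoalg_closed hY).
pose p1 : {linear C -> C} := idfun \- e1.
pose p2 : {linear C -> C} := idfun \- e2.
have p1X x : X x -> p1 x = 0 by move=> Xx; rewrite /p1 /= e1K // subrr.
have p2Y y : Y y -> p2 y = 0 by move=> Yy; rewrite /p2 /= e2K // subrr.
pose p : {linear C -> (C ⊗ C)%type} := tmap p1 p2 \o comul.
have wedge_ker c : wedge X Y c <-> p c = 0.
  split=> [[s [t [Xs Yt cE]]] | pc0].
    rewrite /p /= cE linearD /=.
    by rewrite (tens_sub_ker _ Xs) ?(tens_sub_ker _ Yt) ?addr0; auto.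
  (* Here u ⊗ v = e1 u ⊗ v + p1 u ⊗ e2 v + p1 u ⊗ p2 v, and the last terms add up to p c = 0. *)
  exists (tmap e1 idfun (comul c)), (tmap p1 e2 (comul c)); split.
  - exact: tens_sub_tmap.
  - exact: tens_sub_tmap.
  rewrite -[LHS]subr0 -pc0 /p /=.
  elim/tens_ind: (comul c) => [u v | s t IHs IHt]; last first.
    by rewrite !linearD /= addrACA IHs IHt addrACA.
  rewrite !tmapE [_ ⊗ p2 v]linearBr /= opprB addrA addrAC; congr (_ + _).
  by rewrite linearBl opprB addrC subrK.
have wedge0 : submod_closed [in wedge X Y].
  split=> [|a c d]; rewrite !inE !wedge_ker ?linear0 // => pc pd.
  by rewrite linearP pc pd scaler0 addr0.
split=> // [d Wd | d b [s [t [Xs Yt dE]]]]; last first.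
  exists (ract s b), (ract t b); rewrite comul_hom dE linearDl; split=> //.
    by apply: tens_sub_ract => // x a; apply: submodcoalg_act.
  by apply: tens_sub_ract => // x a; apply: submodcoalg_act.
(* As [e] takes values in the wedge, it suffices that e ⊗ e fixes Δ(d). *)
have [q pqp] := generalized_inverse p.
pose e : {linear C -> C} := idfun \- (q \o p).
have eW c : wedge X Y (e c).
  by apply/wedge_ker; rewrite [LHS]linearB -[X in _ - X]/(p (q (p c))) pqp subrr.
have [s [t [Xs Yt dE]]] := Wd.
(* By coassociativity, (p ⊗ id) Δ = (p1 ⊗ (p2 ⊗ id) Δ) Δ. On X ⊗ C the factor p1 vanishes; on C ⊗ Y
   the other factor does, because Δ(Y) lies in Y ⊗ Y. *)
have split_l : tmap (q \o p) idfun (comul d) = 0.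
  have -> : tmap (q \o p) idfun (comul d) =
      tmap q idfun (tmap (tmap p1 p2) idfun (tmap comul idfun (comul d))).
    elim/tens_ind: (comul d) => [u v | u v IHu IHv]; first by rewrite !tmapE.
    by rewrite 4!linearD /= IHu IHv.
  rewrite (_ : tmap (tmap p1 p2) _ _ = 0) ?linear0 //.
  apply: tassoc_inj; rewrite -tassoc_tmap comulA linear0.
  have -> : tmap p1 (tmap p2 idfun) (tmap idfun comul (comul d)) =
      tmap p1 (tmap p2 idfun \o comul) (comul d).
    elim/tens_ind: (comul d) => [u v | u v IHu IHv]; first by rewrite !tmapE.
    by rewrite 3!linearD /= IHu IHv.
  rewrite dE [LHS]linearD /= (tens_sub_ker _ Xs) ?(tens_sub_ker _ Yt) ?addr0; auto.
  right=> y /(submodcoalg_comul hY) Yy /=.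
  by apply: tens_sub_ker Yy; left.
have split_r : tmap idfun (q \o p) (comul d) = 0.
  have -> : tmap idfun (q \o p) (comul d) =
      tmap idfun q (tmap idfun (tmap p1 p2) (tmap idfun comul (comul d))).
    elim/tens_ind: (comul d) => [u v | u v IHu IHv]; first by rewrite !tmapE.
    by rewrite 4!linearD /= IHu IHv.
  rewrite -comulA tassoc_tmap.
  have -> : tmap (tmap idfun p1) p2 (tmap comul idfun (comul d)) =
      tmap (tmap idfun p1 \o comul) p2 (comul d).
    elim/tens_ind: (comul d) => [u v | u v IHu IHv]; first by rewrite !tmapE.
    by rewrite 3!linearD /= IHu IHv.
  rewrite (_ : tmap _ p2 _ = 0) ?linear0 //.
  rewrite dE [LHS]linearD /= (tens_sub_ker _ Xs) ?(tens_sub_ker _ Yt) ?addr0; auto.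
  left=> x /(submodcoalg_comul hX) Xx /=.
  by apply: tens_sub_ker Xx; right.
have -> : comul d = tmap e e (comul d).
  have -> : tmap e e (comul d) = tmap e idfun (tmap idfun e (comul d)).
    by elim/tens_ind: (comul d) => [u v | u v IHu IHv];
      rewrite ?tmapE // !linearD /= IHu IHv.
  have -> : tmap idfun e (comul d) = comul d - tmap idfun (q \o p) (comul d).
    elim/tens_ind: (comul d) => [u v|u v IHu IHv]; first by rewrite !tmapE linearBr.
    by rewrite !linearD /= IHu IHv addrACA.
  rewrite split_r subr0.
  have -> : tmap e idfun (comul d) = comul d - tmap (q \o p) idfun (comul d).
    elim/tens_ind: (comul d) => [u v|u v IHu IHv]; first by rewrite !tmapE linearBl.
    by rewrite !linearD /= IHu IHv addrACA.
  by rewrite split_l subr0.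
exact: tens_sub_tmap.
Qed.

End Wedge.

(** * Sums of submodule coalgebras *)

Section Sum.
Variables (k : fieldType) (B : bialgType k) (C : modCoalgType B).
Variables (I : Type) (D : I -> set C).

Lemma sum_sub_sup i : D i `<=` sum_sub D.
Proof.
move=> x Dx; exists 1, (fun=> i), (fun=> x); split=> //.
by rewrite big_ord_recl big_ord0 addr0.
Qed.

Lemma sum_subD x y : sum_sub D x -> sum_sub D y -> sum_sub D (x + y).
Proof.
move=> [m [i [u [Du ->]]]] [n [j [v [Dv ->]]]].
pose pick T (f : 'I_m -> T) (g : 'I_n -> T) (l : 'I_(m + n)) :=
  match split l with inl a => f a | inr b => g b end.
exists (m + n), (pick _ i j), (pick _ u v); split.
  by rewrite /pick => l; case: splitP.
have splitl (l : 'I_m) : split (lshift n l) = inl l := @unsplitK m n (inl l).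
have splitr (l : 'I_n) : split (rshift m l) = inr l := @unsplitK m n (inr l).
rewrite big_split_ord /=; congr (_ + _); apply: eq_bigr => l _.
  by rewrite /pick splitl.
by rewrite /pick splitr.
Qed.

Lemma sum_sub_submodcoalg :
  (forall i, is_submodcoalg (D i)) -> is_submodcoalg (sum_sub D).
Proof.
move=> hD; split=> [|_ [n [i [x [Dx ->]]]]|_ b [n [i [x [Dx ->]]]]].
- split=> [|a _ y /set_mem[n [i [x [Dx ->]]]] /set_mem Dy]; apply: mem_set.
    (* Zero is the empty sum; [I] may be empty, so the indices come from elimination on ['I_0]. *)
    have i0 : 'I_0 -> I by case.
    by exists 0, i0, (fun=> 0); split=> [[]//|]; rewrite big_ord0.
  apply: sum_subD => //; exists n, i, (fun j => a *: x j).
  split=> [j|]; last by rewrite scaler_sumr.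
  have [D0 Dlin] := submodcoalg_closed (hD (i j)).
  by rewrite -[a *: _]addr0; apply/set_mem/Dlin => //; apply: mem_set.
- rewrite linear_sum; apply: big_ind => [|s t|j _].
  + exact: tens_sub0.
  + exact: tens_subD.
  have := submodcoalg_comul (hD (i j)) (Dx j).
  by apply: tens_subS; apply: sum_sub_sup.
- exists n, i, (fun j => ract (x j) b); split=> [j|].
    exact: submodcoalg_act.
  by apply: (big_morph (fun u => ract u b)) => [u v|]; rewrite ?linearDl ?linear0l.
Qed.

End Sum.

(** * Cointegrals, projectivity and extension to the wedge *)

Section Cointegral.
Variables (k : fieldType) (H : hopfType k) (C : modCoalgType H).
Local Notation R := (rreg H).
Implicit Types (D : set C) (f phi : {linear C -> R}).

(** The counit condition is imposed on all of [C] because [transfer] evaluates [f] on arbitrary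
    factors of tensors in C ⊗ C. *)
Definition cointegral D f : Prop :=
  (forall c, counit (f c) = counit c) /\
  (forall d b, D d -> f (ract d b) = ract (f d) b).

(** On D ⊗ C the transfer map is f ⊗ eps, so the counit axiom gives back [f]. *)
Lemma transfer_comul (W : rmodType H) (f : {linear C -> W}) phi D c :
  (forall x, counit (phi x) = counit x) ->
  (forall d b, D d -> f (ract d b) = ract (f d) b) ->
  tens_sub D setT (comul c) -> transfer f phi (comul c) = f c.
Proof.
move=> phic fD Dc; rewrite -[in RHS](counitr c).
elim/tens_sub_ind: Dc => [|x y Dx _ | s t IHs IHt].
- by rewrite !linear0.
- by rewrite transfer_homl ?phic => [|b]; rewrite ?tmapE ?tunitrE ?linearZ ?fD.
- by rewrite 4!linearD /= IHs IHt.
Qed.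

Lemma cointegral_projective f : cointegral setT f -> projective C.
Proof.
move=> [fc fhom] M N g u ghom /linear_section[s sK] uhom.
(* [h] is H-linear because [f] is, although [s \o u] is only k-linear; and composing with [g] turns
   [s \o u] into the H-linear map [u]. *)
pose h : {linear C -> M} := transfer (s \o u) f \o comul.
exists h; split=> [c b | c] /=.
  rewrite comul_hom; elim/tens_ind: (comul c) => [x y | t t' IHt IHt'].
    by rewrite transfer_homr // => b'; apply: fhom.
  by rewrite linearDl 2!linearD linearDl /= IHt IHt'.
rewrite transfer_comp // (@transfer_comul _ _ _ setT) ?sK //=.
  by move=> d b _; rewrite !sK uhom.
elim/tens_ind: (comul c) => [x y | t t']; first exact: tens_sub_tens.
exact: tens_subD.
Qed.

Lemma projective_cointegral : projective C -> exists f, cointegral setT f.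
Proof.
move=> projC; have [||| f [fhom fc]] := projC R k^o counit counit.
- exact: counit_hom.
- move=> a; exists ((a : k) *: (1 : H) : R).
  by rewrite linearZ /= [counit _]counit1 [LHS]mulr1.
- exact: counit_hom.
by exists f; split=> // d b _.
Qed.

Lemma cointegral_extend D (Dsub : submod_closed [in D])
    (phi : {linear subspace Dsub -> R}) :
  (forall x, counit (phi x) = counit (incl x)) ->
  exists f, (forall c, counit (f c) = counit c) /\ (forall x, f (incl x) = phi x).
Proof.
move=> phic; have [r rK] := retraction_ex Dsub.
(* The multiple of 1 vanishes on [D] and restores the counit elsewhere: eps(r c) + eps(c - r c) =
   eps(c). *)
have [g gE] : exists g : C -> R, forall c,
    g c = phi (r c) + (counit (c - incl (r c)) : k) *: (1 : H).
  by exists (fun c => phi (r c) + (counit (c - incl (r c)) : k) *: (1 : H)).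
have g_lin : linear g.
  move=> a x y; rewrite !gE; set e := fun c => counit (c - incl (r c)) : k.
  rewrite -[counit _]/(e _) -[counit (x - _)]/(e x) -[counit (y - _)]/(e y).
  have -> : e (a *: x + y) = a * e x + e y.
    rewrite /e -[RHS](linearP counit); congr (counit _).
    by rewrite [r _]linearP [incl _]linearP scalerBr opprD addrACA.
  by rewrite 2!linearP scalerDl scalerDr scalerA addrACA.
pose f : {linear C -> R} := HB.pack g (GRing.isLinear.Build k C R *:%R g g_lin).
exists f; split=> [c | x].
  rewrite /= gE linearD linearZ /= phic [counit (1 : R)]counit1 [_ *: _]mulr1.
  by rewrite linearB /= addrC subrK.
by rewrite /= gE rK subrr linear0 scale0r addr0.
Qed.

(** Δ sends the wedge into D1 ⊗ C + C ⊗ D2, and the transfer map respects the action on each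
    summand. Agreement with [f1] on [D1] is what lets a partial cointegral grow in the Zorn
    argument. *)
Lemma wedge_cointegral D1 D2 f1 f2 :
  is_submodcoalg D1 -> is_submodcoalg D2 ->
  cointegral D1 f1 -> cointegral D2 f2 ->
  exists f, cointegral (wedge D1 D2) f /\ (forall d, D1 d -> f d = f1 d).
Proof.
move=> hD1 hD2 [f1c f1hom] [f2c f2hom].
pose f : {linear C -> R} := transfer f1 f2 \o comul.
exists f; split; last first.
  move=> d D1d; apply: (transfer_comul f2c f1hom).
  by apply: tens_subS (submodcoalg_comul hD1 D1d).
split=> [c /= | d b [s [t [Ds Dt dE]]]].
  (* The counit of H is H-linear and eps f1 = eps, so [transfer_comul] applies to eps f1 on all of
     [C]. *)
  rewrite [LHS](@transfer_comp _ _ _ _ R k^o); last exact: counit_hom.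
  rewrite (@transfer_comul _ _ _ setT) //= ?f1c // => [x b _|].
    by rewrite !f1c counit_hom.
  elim/tens_ind: (comul c) => [x y | t t']; first exact: tens_sub_tens.
  exact: tens_subD.
(* On D1 ⊗ C, the image of x b_1 ⊗ y b_2 is eps(y) eps(b_2) f1(x b_1), which sums to eps(y) f1(x
   b). *)
have homl : transfer f1 f2 (ract s b) = ract (transfer f1 f2 s) b.
  elim/tens_sub_ind: Ds {dE} => [|x y D1x _ | u v IHu IHv].
  - by rewrite linear0l !linear0 linear0l.
  - rewrite [in RHS]transfer_homl; last by move=> b'; apply: f1hom.
    rewrite linearZl /= -f1hom // -[in RHS](counitr b).
    rewrite -[ract _ b]/(tmap2 _ _ _ _).
    elim/tens_ind: (comul b) => [b1 b2 | s' t' IHs IHt]; last first.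
      by rewrite [tmap2 _ _ _ _]linearDr 6!linearD /= IHs IHt.
    rewrite tmap2E transfer_homl => [|b']; last first.
      by apply: f1hom; apply: submodcoalg_act.
    by rewrite tmapE tunitrE !f2c counit_hom linearZr linearZ /= scalerA.
  - by rewrite linearDl 2!linearD linearDl /= -IHu -IHv.
have homr : transfer f1 f2 (ract t b) = ract (transfer f1 f2 t) b.
  elim/tens_sub_ind: Dt {dE} => [|x y _ D2y | u v IHu IHv].
  - by rewrite linear0l !linear0 linear0l.
  - by rewrite transfer_homr // => b'; apply: f2hom.
  - by rewrite linearDl 2!linearD linearDl /= -IHu -IHv.
rewrite -[f d]/(transfer f1 f2 (comul d)).
rewrite -[f _]/(transfer f1 f2 (comul (ract d b))).
rewrite comul_hom dE linearDl 2!linearD linearDl.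
by congr (_ + _); [exact: homl | exact: homr].
Qed.

End Cointegral.

Lemma projective_submodcoalgP (k : fieldType) (H : hopfType k)
    (C : modCoalgType H) (D : set C) (hD : is_submodcoalg D) :
  projective (submodcoalg hD) <-> exists f, cointegral D f.
Proof.
split=> [/projective_cointegral[phi [phic phihom]] | [f [fc fhom]]].
  have [f [fc fE]] := cointegral_extend phic.
  exists f; split=> // d b /submodcoalg_inclP-/(_ hD)[x <-].
  by rewrite -ract_submodcoalg [LHS]fE [f _]fE phihom.
apply: (@cointegral_projective _ _ _ (f \o @submodcoalg_incl _ _ _ _ hD)).
split=> [c | d b _]; first exact: fc.
by rewrite /= [LHS]fhom //; apply/submodcoalg_inclP; exists d.
Qed.

(** * Gluing cointegrals on a sum by Zorn's lemma *)

Section GlueSum.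
Variables (k : fieldType) (H : hopfType k) (C : modCoalgType H).
Local Notation R := (rreg H).

(* Graphs of cointegrals on submodule coalgebras; the empty set is allowed so
   that empty chains have an upper bound. *)
Record cointegral_graph (G : set (C * R)) : Prop := CointegralGraph {
  graph_lin : forall a x y, G x -> G y -> G (a *: x + y);
  graph_fun : forall h, G (0, h) -> h = 0;
  graph_counit : forall x, G x -> counit x.2 = counit x.1;
  graph_act : forall x b, G x -> G (ract x.1 b, ract x.2 b);
  graph_comul : forall x, G x -> tens_sub (fst @` G) (fst @` G) (comul x.1)
}.

Lemma graph_of_cointegral (D : set C) (f : {linear C -> R}) :
  is_submodcoalg D -> cointegral D f ->
  cointegral_graph [set x | D x.1 /\ x.2 = f x.1].
Proof.
move=> hD [fc fhom]; split=> /=.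
- move=> a x y [Dx ->] [Dy ->]; split; last by rewrite linearP.
  have [_ Dlin] := submodcoalg_closed hD.
  by apply/set_mem/Dlin; apply: mem_set.
- by move=> h [_ ->]; rewrite linear0.
- by move=> x [_ ->].
- by move=> x b [Dx ->]; rewrite fhom //; split=> //; apply: submodcoalg_act.
- move=> x [Dx _]; apply: tens_subS (submodcoalg_comul hD Dx).
    by move=> d Dd; exists (d, f d).
  by move=> d Dd; exists (d, f d).
Qed.

Lemma cointegral_of_graph (G : set (C * R)) : G !=set0 -> cointegral_graph G ->
  is_submodcoalg (fst @` G) /\
  (exists f, cointegral (fst @` G) f /\ forall x, G x -> x.2 = f x.1).
Proof.
move=> [x0 Gx0] [Glin Gfun Gcounit Gact Gcomul].
have G0 : G 0 by rewrite -(addNr x0) -scaleN1r; apply: Glin.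
have hG : is_submodcoalg (fst @` G).
  split=> [|_ [x Gx <-]|_ b [x Gx <-]].
  - split=> [|a _ _ /set_mem[x Gx <-] /set_mem[y Gy <-]]; apply: mem_set.
      by exists 0.
    by exists (a *: x + y) => //; apply: Glin.
  - exact: Gcomul.
  - by exists (ract x.1 b, ract x.2 b) => //; apply: Gact.
split=> //; pose Gsub := submodcoalg_closed hG.
have /choice[phi phiP] (u : subspace Gsub) : exists h : R, G (incl u, h).
  by have [[c h] /= Gch cu] := inclP u; exists h; rewrite -cu.
(* Subtracting two points over [u] gives a point over 0, whose second component is 0. *)
have phi_uniq u h : G (incl u, h) -> h = phi u.
  move=> Gh; apply/eqP; rewrite eq_sym -subr_eq0; apply/eqP/Gfun.
  have := Glin (-1) _ _ Gh (phiP u).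
  by rewrite scaleN1r addrC /= -[_ - _]/(_ - _, _ - _) subrr.
have phi_lin : linear phi.
  move=> a u v; symmetry; apply: phi_uniq; rewrite linearP.
  exact: (Glin a _ _ (phiP u) (phiP v)).
pose phi' : {linear subspace Gsub -> R} :=
  HB.pack phi (GRing.isLinear.Build k (subspace Gsub) R *:%R phi phi_lin).
have [|f [fc fE]] := @cointegral_extend _ _ _ _ _ phi'.
  by move=> u; apply: Gcounit (phiP u).
have fG x : G x -> x.2 = f x.1.
  move=> Gx; have [|u uE] := @incl_surj _ _ _ Gsub x.1; first by exists x.
  by rewrite -uE fE; apply: phi_uniq; rewrite uE -surjective_pairing.
exists f; split=> //; split=> // _ b [x Gx <-].
by rewrite -(fG _ (Gact x b Gx)) -fG.
Qed.

Lemma sum_cointegral (I : Type) (D : I -> set C) :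
  (forall i, is_submodcoalg (D i)) -> (forall i, exists f, cointegral (D i) f) ->
  exists f, cointegral (sum_sub D) f.
Proof.
move=> hD cD.
have [|G [graphG Gmax]] := @Zorn_bigcup (C * R)%type cointegral_graph.
  move=> S SP Stot; split.
  - move=> a x y [X SX Xx] [Y SY Yy]; have [XY | YX] := Stot X Y SX SY.
      by exists Y => //; apply: (graph_lin (SP _ SY)) => //; apply: XY.
    by exists X => //; apply: (graph_lin (SP _ SX)) => //; apply: YX.
  - by move=> h [X SX Xh]; apply: (graph_fun (SP _ SX)).
  - by move=> x [X SX Xx]; apply: (graph_counit (SP _ SX)).
  - by move=> x b [X SX Xx]; exists X => //; apply: (graph_act (SP _ SX)).
  - move=> x [X SX Xx]; apply: tens_subS (graph_comul (SP _ SX) Xx);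
      by move=> _ [y Xy <-]; exists y => //; exists X.
have maxE G' : cointegral_graph G' -> G `<=` G' -> G' `<=` G.
  by move=> graphG' GG'; apply: contrapT => G'G; apply: (Gmax G').
have Gneq0 : G !=set0.
  (* A maximal graph is not empty: the graph {0} contains the empty one. *)
  have [//|/set0P/negP/negPn/eqP G0] := pselect (G !=set0).
  exists 0; apply: (maxE [set 0]) => //; last by rewrite G0; apply: sub0set.
  split=> [a _ _ -> ->|h [->]|_ ->|_ b ->|_ ->] //=.
  - by rewrite scaler0 addr0.
  - by rewrite !linear0.
  - by rewrite !linear0l.
  - by rewrite linear0; apply: tens_sub0.
have [hG [f [fG Gf]]] := cointegral_of_graph Gneq0 graphG.
exists f; split=> [|_ b [n [i [x [Dx ->]]]]]; first by case: fG.
(* The cointegral of [G] extends to the wedge of its domain with [D j]; by maximality the extended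
   graph is already in [G], so the domain contains [D j]. *)
have DG j : D j `<=` fst @` G.
  have [fj fjD] := cD j.
  have [g [gW gf]] := wedge_cointegral hG (hD j) fG fjD.
  have /maxE := graph_of_cointegral (wedge_submodcoalg hG (hD j)) gW.
  move=> WG d Dd; exists (d, g d) => //; apply: WG => /=.
    move=> y Gy; have Gy1 : (fst @` G) y.1 by exists y.
    by split; [apply: subset_wedgel | rewrite gf // Gf].
  by split=> //; apply: subset_wedger.
case: fG => _ fhom; apply: fhom.
apply: set_mem; case: (submodcoalg_closed hG) => G0 Glin.
elim/big_rec: _ => // j y _ Gy.
by rewrite -[x j]scale1r; apply: Glin => //; apply/mem_set/DG/Dx.
Qed.

End GlueSum.

(** * The radical class axioms, read through cointegrals *)

Theorem theorem3p2 (k : fieldType) (H : hopfType k) :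
  @idempotent_radical_class k H (fun C : modCoalgType H => @projective k H C).
Proof.
split; first split.
(* The identity of H is a cointegral on H, so the class is not empty. *)
- exists (rreg H); apply: (@cointegral_projective _ _ _ idfun); split=> //.
- move=> C D hD /projective_cointegral[f [fc fhom]].
  by apply/projective_submodcoalgP; exists f; split=> // d b _; apply: fhom.
- move=> C I D RD.
  have hD i : is_submodcoalg (D i) by have [] := RD i.
  exists (sum_sub_submodcoalg hD); apply/projective_submodcoalgP.
  apply: sum_cointegral => // i.
  by have [hDi /projective_submodcoalgP] := RD i.
move=> C D1 D2 [hD1 /projective_submodcoalgP[f1 f1D]].
move=> [hD2 /projective_submodcoalgP[f2 f2D]].
exists (wedge_submodcoalg hD1 hD2); apply/projective_submodcoalgP.
by have [f [fW _]] := wedge_cointegral hD1 hD2 f1D f2D; exists f.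
Qed.
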